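(* Let $k$ be a field, $n\ge 1$, $S_n=k[x_1,\ldots,x_n]$ with its standard grading, and let $Q\subset S_n$ be the ideal generated by a regular sequence of length $n$ consisting of homogeneous elements of degree $2$. Then for every integer $s\ge 1$ the Hilbert series of $S_n/Q^s$ is $$\sum_{i=0}^{2s-1}\binom{i+n-1}{n-1}t^i+\sum_{i=2s}^{2s+n-2}\ \sum_{0\le j\le s-1}\binom{n+j-1}{n-1}\binom{n}{i-2j}\,t^i .$$
   Context: The Hilbert series of a graded $k$-algebra $R=\bigoplus_{i\ge 0}R_i$ is $\sum_{i\ge 0}\dim_k(R_i)\,t^i$. Binomial coefficients $\binom{n}{m}$ with $m<0$ or $m>n\ge 0$ are $0$; an empty sum is $0$. *)

(* Defs.v *)
(* Ideals are boolean predicates, as the quotient construction requires;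
   [boolp] provides the booleans classically, membership being undecidable. *)
From HB Require Import structures.
From mathcomp Require Import all_boot all_order all_algebra.
From mathcomp Require Import ring_quotient mpoly boolp.

Set Implicit Arguments.
Unset Strict Implicit.
Unset Printing Implicit Defensive.

Import GRing.Theory.
Local Open Scope ring_scope.
Local Open Scope quotient_scope.

Section Ideals.
Variables (K : comNzRingType) (A : comAlgType K).
Implicit Types (I J : {pred A}) (s : seq A).

Definition ideal_gen s : {pred A} :=
  [pred x | `[< exists c : 'I_(size s) -> A, x = \sum_i c i * s`_i >]].

Definition ideal_mul I J : {pred A} :=
  [pred x | `[< exists2 r : seq (A * A),
                  {in r, forall ab, ab.1 \in I /\ ab.2 \in J} &
                  x = \sum_(ab <- r) ab.1 * ab.2 >]].

Fixpoint ideal_exp I m : {pred A} :=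
  if m is m'.+1 then ideal_mul I (ideal_exp I m') else predT.

(* "[s`_i] is a nonzerodivisor on [A / (s_0, ..., s_(i-1))]" is spelled out on
   representatives, since this quotient is not known to be nonzero. *)
Definition regular_sequence s : Prop :=
  1 \notin ideal_gen s /\
  forall i, (i < size s)%N -> forall x,
    x * s`_i \in ideal_gen (take i s) -> x \in ideal_gen (take i s).

Lemma ideal_exp_ideal I m :
  0 \in ideal_exp I m /\
  forall a, {in ideal_exp I m &, forall x y, a * x + y \in ideal_exp I m}.
Proof.
elim: m => [|m [exp0 IHm]] //=; split.
  by apply/asboolP; exists [::]; rewrite ?big_nil.
move=> a _ _ /asboolP[r rP ->] /asboolP[t tP ->]; apply/asboolP.
exists ([seq (ab.1, a * ab.2) | ab <- r] ++ t).
  move=> ab; rewrite mem_cat => /orP[/mapP[cd /rP[cI dJ] ->]|/tP //].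
  split=> //=; rewrite -[a * _]addr0; exact: IHm.
rewrite big_cat big_map mulr_sumr; congr (_ + _).
by apply: eq_bigr => ab _; rewrite mulrCA.
Qed.

Lemma ideal_exp_submod_closed I m : GRing.submod_closed (ideal_exp I m).
Proof.
have [I0 IM] := ideal_exp_ideal I m; split=> // a x y xI yI.
by rewrite -mulr_algl; apply: IM.
Qed.

HB.instance Definition _ I m :=
  GRing.isSubmodClosed.Build K A (ideal_exp I m) (ideal_exp_submod_closed I m).

End Ideals.

(* [ring_quotient] only makes [Quotient.quot I] a Z-module, and requires [I] to
   be declared closed under opposite, which [submodClosed] does not record. *)
Section QuotientModule.
Variables (K : nzRingType) (V : lmodType K) (I : submodClosed V).

Definition submod_pred : {pred V} := I.

Lemma submod_pred_zmod_closed : zmod_closed submod_pred.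
Proof.
split=> [|x y xI yI]; rewrite /submod_pred ?rpred0 //.
by rewrite -scaleN1r rpredD // rpredZ.
Qed.

HB.instance Definition _ :=
  GRing.isZmodClosed.Build V submod_pred submod_pred_zmod_closed.

Definition quotmod := Quotient.quot submod_pred.
HB.instance Definition _ := GRing.Zmodule.on quotmod.

Definition quot_proj (v : V) : quotmod := \pi_(Quotient.quot submod_pred) v.

Definition quot_scale (a : K) (x : quotmod) : quotmod :=
  quot_proj (a *: repr (x : Quotient.quot submod_pred)).

Lemma quot_projK (x : quotmod) :
  quot_proj (repr (x : Quotient.quot submod_pred)) = x.
Proof. exact: reprK. Qed.

Lemma quot_projD : {morph quot_proj : x y / x + y}.
Proof. by move=> x y; apply: (raddfD (\pi_(Quotient.quot submod_pred))). Qed.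

Lemma quot_projZ a v : quot_scale a (quot_proj v) = quot_proj (a *: v).
Proof.
apply/eqP; rewrite /quot_scale /quot_proj -Quotient.idealrBE -scalerBr.
apply: (@rpredZ K V I); have := reprK (\pi_(Quotient.quot submod_pred) v).
by move/eqP; rewrite -Quotient.idealrBE.
Qed.

Lemma quot_scalerA a b x : quot_scale a (quot_scale b x) = quot_scale (a * b) x.
Proof. by rewrite -[x]quot_projK !quot_projZ scalerA. Qed.

Lemma quot_scale1r : left_id 1 quot_scale.
Proof. by move=> x; rewrite -[x]quot_projK quot_projZ scale1r. Qed.

Lemma quot_scalerDr : right_distributive quot_scale +%R.
Proof.
move=> a x y; rewrite -[x]quot_projK -[y]quot_projK -quot_projD !quot_projZ.
by rewrite scalerDr quot_projD.
Qed.

Lemma quot_scalerDl x : {morph quot_scale^~ x : a b / a + b}.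
Proof.
by move=> a b; rewrite -[x]quot_projK !quot_projZ scalerDl quot_projD.
Qed.

HB.instance Definition _ := GRing.Zmodule_isLmodule.Build K quotmod
  quot_scalerA quot_scale1r quot_scalerDr quot_scalerDl.

End QuotientModule.

(* [P] is meant to be a subspace of [V], and [V] may be infinite-dimensional, so
   that [vectType] and [\dim] do not apply. *)
Definition has_dim (K : fieldType) (V : lmodType K) (P : V -> Prop) (d : nat) :
    Prop :=
  exists b : 'I_d -> V,
    [/\ forall i, P (b i),
        forall c : 'I_d -> K, \sum_i c i *: b i = 0 -> forall i, c i = 0 &
        forall x, P x -> exists c : 'I_d -> K, x = \sum_i c i *: b i].

Section HilbertSeries.
Variables (k : fieldType) (n : nat) (I : submodClosed {mpoly k[n]}).

(* These pieces grade the quotient when [I] is homogeneous. *)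
Definition quot_graded_piece (i : nat) (x : quotmod I) : Prop :=
  exists2 p : {mpoly k[n]}, p \is i.-homog & x = quot_proj I p.

(* A power series is given by its sequence of coefficients. *)
Definition has_hilbert_series (H : nat -> nat) : Prop :=
  forall i, has_dim (quot_graded_piece i) (H i).

End HilbertSeries.

(* Main.v *)
From HB Require Import structures.
Require Import Defs.
From mathcomp Require Import all_boot all_order all_algebra.
From mathcomp Require Import zify ring_quotient mpoly boolp.

(** Write [N = n.+1] for the number of variables, [S] for the polynomial ring,
    [Q] for the ideal generated by the sequence [f], and [h_i d] for the
    dimension of the degree [d] part of [S / (f_0, ..., f_(i-1))].

    Since [f_i] is a nonzerodivisor of degree 2 modulo its predecessors,
    [h_(i+1) (d+2) + h_i d = h_i (d+2)] ([codim_rcons]).  The coefficients of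
    [(1 + t)^i (1 - t)^-(N-i)] satisfy the same recursion, hence
    [S / Q] has Hilbert series [(1 + t)^N] ([codim_gen]).

    For the powers of [Q], only an upper bound is proved directly: [Q^s] is
    generated by the monomials of degree [s] in the [f_i], of which there are
    ['C(s + n, s)], so that in degree [2s + e] the quotient [Q^s / Q^(s+1)] is
    spanned by the products of these monomials with a basis of a complement of
    [Q] in degree [e].  Thus its dimension is at most ['C(s + n, s) * 'C(N, e)]
    ([pow_step]).  Summed over all [s] in a fixed degree [d], these bounds give
    [\sum_j 'C(j + n, j) * 'C(N, d - 2j)], the coefficient of [t^d] in
    [(1 - t^2)^-N (1 + t)^N = (1 - t)^-N], that is, exactly the dimension of
    the space of forms of degree [d] ([hsc_sum], [hsc_poly]).  So every bound
    is an equality, which gives the Hilbert function of [S / Q^s]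
    ([codim_pow]); no separate proof that a regular sequence is quasi-regular
    is needed.

    Below degree [2s] the ideal [Q^s] vanishes, and from degree [2s + N - 1] on
    all the terms ['C(N, d - 2j)] with [j < s] vanish; this gives the two sums
    of the theorem ([hilbert_coef]). *)

Set Implicit Arguments.
Unset Strict Implicit.

(** * Coefficients of (1 + t)^p (1 - t)^-r *)

(** The coefficient of [t^d] in [(1 + t)^p (1 - t)^-r]; dividing by [1 - t]
    amounts to taking partial sums. *)
Fixpoint hsc p r d :=
  if r is r'.+1 then \sum_(j < d.+1) hsc p r' j else 'C(p, d).

Lemma hsc0 p r : hsc p r 0 = 1.
Proof. by elim: r => [|r IHr] /=; rewrite ?bin0 // big_ord1. Qed.

Lemma hscS p r d : hsc p r.+1 d.+1 = hsc p r.+1 d + hsc p r d.+1.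
Proof. by rewrite /= big_ord_recr. Qed.

(** Multiplication of the series by [1 + t]. *)
Lemma hsc_pascal p r d : hsc p.+1 r d.+1 = hsc p r d.+1 + hsc p r d.
Proof.
elim: r d => [|r IHr] d; first by rewrite /= binS.
elim: d => [|d IHd]; first by rewrite !hscS IHr !hsc0; lia.
by rewrite hscS IHd IHr (hscS p r d.+1) (hscS p r d); lia.
Qed.

(** Multiplication of [(1 + t)^p (1 - t)^-(r+1)] by [1 - t^2]. *)
Lemma hsc_step p r d : hsc p r.+1 d.+2 = hsc p.+1 r d.+2 + hsc p r.+1 d.
Proof. by rewrite hscS (hscS p r d) hsc_pascal; lia. Qed.

Lemma hsc_step_small p r d : d < 2 -> hsc p r.+1 d = hsc p.+1 r d.
Proof.
by case: d => [|[|d]] // _; rewrite ?hscS ?hsc_pascal ?hsc0 // addnC.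
Qed.

Lemma hsc_poly r d : hsc 0 r.+1 d = 'C(d + r, d).
Proof.
elim: r d => [|r IHr] d.
  by rewrite addn0 binn /= big_ord_recl big1 // => i _; rewrite bin0n.
elim: d => [|d IHd]; first by rewrite hsc0 bin0.
by rewrite hscS IHd IHr [in RHS]addSn binS addnS addSn addnC.
Qed.

(** The identity [(1 + t)^p (1 - t)^-r = (1 - t^2)^-r (1 + t)^(p + r)].  For
    [r = 0] the factor ['C((r + j).-1, j)] is 1 at [j = 0], and 0 elsewhere. *)
Lemma hsc_sum p r d :
  hsc p r d = \sum_(j < d./2.+1) 'C((r + j).-1, j) * 'C(p + r, d - 2 * j).
Proof.
elim: r p d => [|r IHr] p d.
  rewrite big_ord_recl /= bin0 mul1n subn0 addn0 big1 ?addn0 // => i _.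
  by rewrite bin_small.
have [m] := ubnP d; elim: m d => [//|m IHm] [|[|d]] ltdm.
- by rewrite hsc_step_small // IHr !big_ord1 /= ?bin0 ?addnS ?addSn.
- by rewrite hsc_step_small // IHr !big_ord1 /= ?bin0 ?addnS ?addSn.
rewrite hsc_step IHr IHm //; last by lia.
rewrite addSnnS; move: (p + r.+1) => N.
rewrite big_ord_recl [in RHS]big_ord_recl /= !bin0 -addnA.
congr (_ + _); rewrite -big_split /=; apply: eq_bigr => i _.
rewrite /bump /= !add1n !addnS /= binS mulnDl.
by have -> : d.+2 - 2 * i.+1 = d - 2 * i by lia.
Qed.

Import GRing.Theory.
Local Open Scope ring_scope.

(** * Ideals and their generators *)

Section Ideals.
Variables (K : comNzRingType) (A : comAlgType K).
Implicit Types (I J : {pred A}) (s : seq A).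

(** The closure properties of an ideal, in the form in which [ideal_exp_ideal]
    states them. *)
Definition is_ideal I :=
  0 \in I /\ forall a, {in I &, forall x y, a * x + y \in I}.

Lemma ideal_submod I : is_ideal I -> GRing.submod_closed I.
Proof.
by case=> I0 IM; split=> // a x y xI yI; rewrite -mulr_algl; apply: IM.
Qed.

Lemma idealM I a x : is_ideal I -> x \in I -> a * x \in I.
Proof. by case=> I0 IM xI; rewrite -[a * x]addr0 IM. Qed.

Lemma idealD I x y : is_ideal I -> x \in I -> y \in I -> x + y \in I.
Proof. by case=> I0 IM xI yI; rewrite -[x]mul1r IM. Qed.

Lemma ideal_sum I (T : Type) (r : seq T) (P : pred T) (F : T -> A) :
  is_ideal I -> (forall i, P i -> F i \in I) -> \sum_(i <- r | P i) F i \in I.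
Proof.
move=> idI FI; apply: (big_ind (fun x => x \in I)) => //; first by case: idI.
by move=> x y; apply: idealD.
Qed.

Lemma ideal_gen_ideal s : is_ideal (ideal_gen s).
Proof.
split=> [|a x y /asboolP[c ->] /asboolP[d ->]]; apply/asboolP.
  by exists (fun=> 0); rewrite big1 // => i _; rewrite mul0r.
exists (fun i => a * c i + d i); rewrite mulr_sumr -big_split /=.
by apply: eq_bigr => i _; rewrite mulrDl mulrA.
Qed.

Lemma mem_ideal_gen s x : x \in s -> x \in ideal_gen s.
Proof.
move=> xs; apply/asboolP; rewrite -index_mem in xs.
exists (fun i => (i == Ordinal xs)%:R).
rewrite (bigD1 (Ordinal xs)) //= eqxx mul1r nth_index -?index_mem //.
by rewrite big1 ?addr0 // => i /negPf->; rewrite mul0r.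
Qed.

Lemma ideal_gen_min s I :
  is_ideal I -> {subset s <= I} -> {subset ideal_gen s <= I}.
Proof.
move=> idI sI x /asboolP[c ->]; apply: ideal_sum => // i _.
by apply: idealM => //; apply/sI/mem_nth.
Qed.

Lemma ideal_gen_rcons s a x : x \in ideal_gen (rcons s a) ->
  exists2 y, y \in ideal_gen s & exists c, x = y + c * a.
Proof.
pose J : {pred A} :=
  [pred x | `[< exists2 y, y \in ideal_gen s & exists c, x = y + c * a >]].
have idS := ideal_gen_ideal s.
suff sub : {subset ideal_gen (rcons s a) <= J} by move=> /sub/asboolP.
apply: ideal_gen_min.
  split=> [|b _ _ /asboolP[y ys [c ->]] /asboolP[z zs [e ->]]]; apply/asboolP.
    by exists 0; [case: idS | exists 0; rewrite mul0r addr0].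
  exists (b * y + z); first by case: idS => _; apply.
  by exists (b * c + e); rewrite mulrDr mulrDl addrACA mulrA.
move=> y; rewrite mem_rcons inE => /orP[/eqP->|ys]; apply/asboolP.
  by exists 0; [case: idS | exists 1; rewrite mul1r add0r].
by exists y; [apply: mem_ideal_gen | exists 0; rewrite mul0r addr0].
Qed.

Lemma ideal_mulM I J x y : x \in I -> y \in J -> x * y \in ideal_mul I J.
Proof.
move=> xI yJ; apply/asboolP; exists [:: (x, y)]; rewrite ?big_seq1 //.
by move=> ab; rewrite inE => /eqP->.
Qed.

Lemma ideal_mul_min I J L : is_ideal L ->
  (forall x y, x \in I -> y \in J -> x * y \in L) ->
  {subset ideal_mul I J <= L}.
Proof.
move=> idL IJL _ /asboolP[r rP ->]; rewrite big_seq_cond.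
by apply: ideal_sum => // ab /andP[/rP[]]; auto.
Qed.

End Ideals.

(** * Generators of the powers of an ideal *)

Section Powers.
Variables (K : comNzRingType) (A : comAlgType K) (n : nat) (f : n.-tuple A).

(** The monomial [m] evaluated at the generators [f]. *)
Definition fmon (m : 'X_{1..n}) : A := mmap1 (tnth f) m.

(** The monomials of degree [s] in [n] variables, without repetition. *)
Definition mons s := [seq s2m (val t) | t <- enum (basis n s)].

Lemma mem_mons s m : (m \in mons s) = (mdeg m == s).
Proof. by rewrite basis_cover. Qed.

Lemma fmonD m1 m2 : fmon (m1 + m2)%MM = fmon m1 * fmon m2.
Proof. by apply: commr_mmap1_M => i x; rewrite /GRing.comm mulrC. Qed.

Lemma fmon_exp m s : mdeg m = s -> fmon m \in ideal_exp (ideal_gen f) s.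
Proof.
elim: s m => [|s IHs] m // dm.
have [i mi] : exists i, (0 < m i)%N.
  apply/existsP; rewrite -[X in is_true X]negbK negb_exists.
  apply/negP=> /forallP m0; move: dm; rewrite mdegE big1 // => i _.
  by apply/eqP; move: (m0 i); lia.
have mE : m = (U_(i) + (m - U_(i)))%MM by rewrite addmC submK // lep1mP -lt0n.
rewrite mE fmonD /=; apply: ideal_mulM.
  by rewrite /fmon mmap1U; apply/mem_ideal_gen/mem_tnth.
apply: IHs; move: dm; rewrite {1}mE mdegD mdeg1; lia.
Qed.

Lemma ideal_exp_gen s :
  ideal_exp (ideal_gen f) s =i ideal_gen [seq fmon m | m <- mons s].
Proof.
move=> x; apply/idP/idP; last first.
  apply: ideal_gen_min; first exact: ideal_exp_ideal.
  by move=> _ /mapP[m + ->]; rewrite mem_mons => /eqP; apply: fmon_exp.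
have idG s' := ideal_gen_ideal [seq fmon m | m <- mons s'].
elim: s x => [|s IHs] x.
  move=> _; rewrite -[x]mulr1; apply: idealM => //.
  apply/mem_ideal_gen/mapP; exists 0%MM; rewrite ?mem_mons ?mdeg0 //.
  by rewrite /fmon mmap11.
apply: ideal_mul_min => // {x} x y + /IHs.
case/asboolP=> c -> /asboolP[e ->]; rewrite mulr_suml.
apply: ideal_sum => // i _; rewrite mulr_sumr.
apply: ideal_sum => // j _; rewrite mulrACA; apply: idealM => //.
have si : (i < n)%N by rewrite -{2}(size_tuple f).
have sj : (j < size (mons s))%N by rewrite -(size_map fmon).
apply/mem_ideal_gen/mapP; exists (U_(Ordinal si) + nth 0%MM (mons s) j)%MM.
  by rewrite mem_mons mdegD mdeg1 add1n eqSS -mem_mons mem_nth.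
rewrite fmonD (nth_map 0%MM) // /fmon mmap1U.
by rewrite (tnth_nth 0).
Qed.

End Powers.

(** * Graded pieces as finite-dimensional subspaces *)

(** A predicate closed under linear combinations is a subspace: take one of
    maximal dimension among the subspaces contained in it. *)
Lemma ex_subspace (k : fieldType) (V : vectType k) (P : {pred V}) :
  GRing.submod_closed P -> exists U : {vspace V}, U =i P.
Proof.
move=> [P0 PM].
pose Q d := `[< exists2 U : {vspace V}, {subset U <= P} & \dim U = d >].
have exQ : exists d, Q d.
  exists 0%N; apply/asboolP; exists 0%VS; rewrite ?dimv0 // => x.
  by rewrite memv0 => /eqP->.
have bQ d : Q d -> (d <= \dim {:V})%N.
  by case/asboolP=> U _ <-; rewrite dimvS ?subvf.
case: (ex_maxnP exQ bQ) => d /asboolP[U UP dU] dmax.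
exists U => x; apply/idP/idP=> [/UP //|xP].
suff dUx : (\dim (U + <[x]>) <= \dim U)%N.
  have /eqP -> : U == (U + <[x]>)%VS by rewrite eqEdim addvSl.
  by apply: (subvP (addvSr _ _)); rewrite memv_line.
rewrite dU; apply: dmax; apply/asboolP; exists (U + <[x]>)%VS => // y.
case/memv_addP=> u uU [v /vlineP[a ->] ->].
by rewrite addrC; apply: PM => //; apply: UP.
Qed.

Section Pieces.
Variables (k : fieldType) (n : nat).
Local Notation S := {mpoly k[n.+1]}.
Local Notation Sd d := (dhomog n.+1 k d).
Implicit Types (I J : {pred S}).

Lemma piece_subproof I d :
  exists U : {vspace Sd d},
    GRing.submod_closed I -> forall x, (x \in U) = (val x \in I).
Proof.
have [[I0 IM]|nI] := pselect (GRing.submod_closed I); last by exists 0%VS.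
pose P : {pred Sd d} := [pred x | val x \in I].
have clP : GRing.submod_closed P.
  by split=> [|a x y]; rewrite !inE /=; [|apply: IM].
have [U UE] := ex_subspace clP.
by exists U => _ x; rewrite UE.
Qed.

(** The space of forms of degree [d] that belong to [I]; it is meaningful only
    if [I] is closed under linear combinations. *)
Definition piece I d := projT1 (cid (piece_subproof I d)).

Lemma pieceE I d x : GRing.submod_closed I -> (x \in piece I d) = (val x \in I).
Proof. by rewrite /piece; case: cid => U /= UE /UE. Qed.

(** The homogeneous component of degree [d], as a linear map. *)
Definition hproj d (p : S) : Sd d := DHomog (pihomogP mdeg d p).

Lemma hproj_linear d : linear (hproj d).
Proof. by move=> a p q; apply: val_inj; rewrite /= linearP. Qed.
HB.instance Definition _ d :=
  GRing.isLinear.Build k S (Sd d) _ (hproj d) (hproj_linear d).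

(** Multiplication by [P] from forms of degree [e] to forms of degree [d].  The
    degree [d] component of the product is taken so that the map is defined for
    all [P], [e] and [d]; it is the product itself if [P] is homogeneous of
    degree [c] and [d = c + e] (lemma [hmulE]). *)
Definition hmul_fun (P : S) e d (x : Sd e) : Sd d := hproj d (P * val x).

Lemma hmul_linear P e d : linear (@hmul_fun P e d).
Proof.
by move=> a x y; rewrite /hmul_fun linearP /= mulrDr -scalerAr linearP.
Qed.
HB.instance Definition _ P e d :=
  GRing.isLinear.Build k (Sd e) (Sd d) _ (@hmul_fun P e d) (@hmul_linear P e d).

Definition hmul P e d : 'Hom(Sd e, Sd d) := linfun (@hmul_fun P e d).

Lemma hmulE P c e x : P \is c.-homog -> val (hmul P e (c + e) x) = P * val x.
Proof.
move=> hP; rewrite lfunE /= pihomog_dE //.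
by apply: dhomogM => //; apply: dhomog_is_dhomog.
Qed.

Lemma pihomog_mul d e (p q : S) : q \is e.-homog ->
  pihomog mdeg d (p * q) = if (e <= d)%N then pihomog mdeg (d - e) p * q else 0.
Proof.
move=> hq; pose K := maxn (mmeasure mdeg p) d.+1.
have hpi i : pihomog mdeg i p * q \is (i + e).-homog.
  by apply: dhomogM => //; apply: pihomogP.
rewrite {1}(@pihomog_partitionE _ _ mdeg K p) ?leq_maxl //.
rewrite mulr_suml linear_sum /=; case: leqP => [ed|de]; last first.
  by rewrite big1 // => i _; apply: pihomog_ne0 (hpi i); lia.
have dK : (d - e < K)%N by rewrite leq_max; apply/orP; right; lia.
rewrite (bigD1 (Ordinal dK)) //= pihomog_dE; last first.
  by have := hpi (d - e)%N; rewrite subnK.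
rewrite big1 ?addr0 // => i /eqP ne; apply: pihomog_ne0 (hpi i).
by apply/eqP=> Ed; apply: ne; apply: val_inj; rewrite /= -Ed addnK.
Qed.

End Pieces.

(** * The Hilbert function modulo a regular sequence *)

Section Regular.
Variables (k : fieldType) (n : nat).
Local Notation S := {mpoly k[n.+1]}.
Local Notation Sd d := (dhomog n.+1 k d).
Implicit Types (I J : {pred S}).

(** The dimension of the degree [d] piece of the quotient by [I]. *)
Definition codim I d := (\dim {: Sd d} - \dim (piece I d))%N.

Lemma dimS d : \dim {: Sd d} = 'C(d + n, d).
Proof. by rewrite dimvf. Qed.

Lemma codimE I d : (codim I d + \dim (piece I d) = \dim {: Sd d})%N.
Proof. by rewrite subnK // dimvS ?subvf. Qed.

Lemma dim_hmul P c e (U : {vspace Sd e}) : P \is c.-homog -> P != 0 ->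
  \dim (hmul P e (c + e) @: U) = \dim U.
Proof.
move=> hP P0; apply: limg_dim_eq; apply/eqP; rewrite -subv0.
apply/subvP=> x; rewrite memv_cap memv_ker memv0 => /andP[_ /eqP Px0].
have := hmulE x hP; rewrite Px0 => /esym/eqP.
by rewrite linear0 mulf_eq0 (negPf P0) /= => /eqP Ex; apply/eqP/val_inj.
Qed.

Lemma ideal_gen_homog (t : seq S) e d (p : S) :
  {in t, forall q, q \is e.-homog} ->
  p \in ideal_gen t -> pihomog mdeg d p \in ideal_gen t.
Proof.
move=> ht /asboolP[c ->]; rewrite linear_sum /=.
have idt := ideal_gen_ideal (A := S) t.
apply: ideal_sum => // i _; rewrite (pihomog_mul d _ (ht _ (mem_nth _ _))) //.
case: ifP => _; last by case: idt.
by apply: idealM => //; apply/mem_ideal_gen/mem_nth.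
Qed.

(** The exact sequence [0 -> S/(t) -> S/(t) -> S/(t, g) -> 0] given by
    multiplication by [g], in degrees [d] and [d + 2]. *)
Lemma codim_rcons (t : seq S) (g : S) d :
  {in t, forall q, q \is 2.-homog} -> g \is 2.-homog -> g != 0 ->
  (forall x, x * g \in ideal_gen t -> x \in ideal_gen t) ->
  (codim (ideal_gen (rcons t g)) d.+2 + codim (ideal_gen t) d
   = codim (ideal_gen t) d.+2)%N.
Proof.
move=> ht hg g0 reg.
have cl s := ideal_submod (ideal_gen_ideal (A := S) s).
pose F := piece (ideal_gen t).
pose G : {vspace Sd d.+2} := limg (hmul g d d.+2).
have EU : piece (ideal_gen (rcons t g)) d.+2 = (F d.+2 + G)%VS.
  apply/vspaceP=> x; apply/idP/idP; rewrite pieceE //.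
    case/ideal_gen_rcons=> y yt [c Ex].
    have -> : x = hproj d.+2 y + hmul g d d.+2 (hproj d c).
      apply: val_inj; rewrite /= (hmulE (c := 2)) //= mulrC.
      have := pihomog_mul d.+2 c hg; rewrite /= subn2 /= => <-.
      by rewrite -pihomogD -Ex pihomog_dE //; apply: dhomog_is_dhomog.
    rewrite memv_add ?memv_img ?memvf // pieceE //=.
    exact: ideal_gen_homog ht yt.
  case/memv_addP=> y; rewrite pieceE // => yt [z /memv_imgP[c _ ->] ->].
  rewrite linearD /= (hmulE (c := 2)) //; apply: idealD.
  - exact: ideal_gen_ideal.
  - apply: ideal_gen_min yt; first exact: ideal_gen_ideal.
    by move=> q qt; apply: mem_ideal_gen; rewrite mem_rcons inE qt orbT.
  rewrite mulrC; apply: idealM; first exact: ideal_gen_ideal.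
  by apply: mem_ideal_gen; rewrite mem_rcons inE eqxx.
have EI : (F d.+2 :&: G = hmul g d d.+2 @: F d)%VS.
  apply/vspaceP=> x; rewrite memv_cap pieceE //.
  apply/andP/memv_imgP=> [[xt /memv_imgP[c _ Ex]]|[c + ->]].
    exists c => //; rewrite pieceE //; apply: reg.
    by rewrite mulrC -(hmulE (c := 2)) // -[hmul _ _ _ _]Ex.
  rewrite pieceE // => ct; split; last by rewrite memv_img ?memvf.
  by rewrite (hmulE (c := 2)) //; apply: idealM => //; apply: ideal_gen_ideal.
have dG : \dim G = \dim {: Sd d} := dim_hmul fullv hg g0.
have dFg : \dim (hmul g d d.+2 @: F d) = \dim (F d) := dim_hmul (F d) hg g0.
have := dimv_sum_cap (F d.+2) G; rewrite EI -EU dG dFg.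
have := codimE (ideal_gen t) d; have := codimE (ideal_gen t) d.+2.
by have := codimE (ideal_gen (rcons t g)) d.+2; rewrite -!/(F _); lia.
Qed.

Lemma piece_small (t : seq S) e d : {in t, forall q, q \is e.-homog} ->
  (d < e)%N -> piece (ideal_gen t) d = 0%VS.
Proof.
move=> ht de; apply/eqP; rewrite -subv0; apply/subvP=> x.
rewrite pieceE; last exact/ideal_submod/ideal_gen_ideal.
case/asboolP=> c Ex; rewrite memv0; apply/eqP/val_inj => /=.
rewrite -[LHS](@pihomog_dE _ _ mdeg d); last exact: dhomog_is_dhomog.
rewrite Ex linear_sum big1 // => i _ /=.
by rewrite (pihomog_mul d _ (ht _ (mem_nth _ _))) // leqNgt de.
Qed.

Lemma codim_take (f : seq S) i d :
  {in f, forall q, q \is 2.-homog} -> regular_sequence f ->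
  (size f <= n.+1)%N -> (i <= size f)%N ->
  codim (ideal_gen (take i f)) d = hsc i (n.+1 - i) d.
Proof.
move=> hf [f1 reg] szf; elim: i d => [|i IHi] d ltif.
  rewrite subn0 hsc_poly /codim take0 (@piece_small _ d.+1) // dimv0 subn0 dimS.
  by rewrite -bin_sub ?leq_addr // addKn.
have ht j : {in take j f, forall q, q \is 2.-homog}.
  by move=> q /mem_take/hf.
have idf s := ideal_gen_ideal (A := S) s.
have Ni : (n.+1 - i = (n.+1 - i.+1).+1)%N by lia.
have IH e : codim (ideal_gen (take i f)) e = hsc i (n.+1 - i) e.
  by apply: IHi; apply: ltnW.
have [d2|] := ltnP d 2.
  have := IH d; rewrite /codim !(@piece_small _ 2) // Ni => ->.
  exact: hsc_step_small.
case: d => [|[|d]] // _.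
(* If [f_i] were 0, then 1 would belong to the ideal of its predecessors,
   hence to the ideal generated by the whole sequence. *)
have fi0 : f`_i != 0.
  apply: contraNneq f1 => f0; apply: (@ideal_gen_min _ S (take i f)) => //.
    by move=> q /mem_take/mem_ideal_gen.
  by apply: reg; rewrite // f0 mulr0; case: (idf (take i f)).
rewrite (take_nth 0) //; apply: (@addIn (hsc i (n.+1 - i) d)).
rewrite -{1}(IH d) codim_rcons ?IH //; last exact: reg.
  by rewrite Ni hsc_step.
by apply: hf; apply: mem_nth.
Qed.

End Regular.

(** * The Hilbert function modulo a power *)

Section PowerCodim.
Variables (k : fieldType) (n : nat).
Local Notation S := {mpoly k[n.+1]}.
Local Notation Sd d := (dhomog n.+1 k d).
Variable f : n.+1.-tuple S.
Hypothesis hf : forall i, tnth f i \is 2.-homog.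
Hypothesis reg : regular_sequence f.
Local Notation Q := (ideal_gen f).
Local Notation W s d := (piece (ideal_exp Q s) d).

Lemma fmon_homog s m : mdeg m = s -> fmon f m \is (2 * s).-homog.
Proof.
move=> <-; rewrite mdegE big_distrr /=.
rewrite /fmon /mmap1.
apply: (big_rec2 (fun e (p : S) => p \is e.-homog)) => [|i e p _ hp].
  exact: dhomog1.
by apply: dhomogM => //; apply: dhomogMn.
Qed.

Lemma mons_homog s :
  {in [seq fmon f m | m <- mons n.+1 s], forall q, q \is (2 * s).-homog}.
Proof. by move=> _ /mapP[m + ->]; rewrite mem_mons => /eqP/fmon_homog. Qed.

Lemma exp_submod s : GRing.submod_closed (ideal_exp Q s).
Proof. exact/ideal_submod/ideal_exp_ideal. Qed.

Lemma mem_pow s d x :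
  (x \in W s d) = (val x \in ideal_gen [seq fmon f m | m <- mons n.+1 s]).
Proof. by rewrite pieceE -?ideal_exp_gen //; apply: exp_submod. Qed.

Lemma pow_small s d : (d < 2 * s)%N -> W s d = 0%VS.
Proof.
move=> ds; rewrite -(piece_small (@mons_homog s) ds).
apply/vspaceP=> x; rewrite mem_pow pieceE //.
exact/ideal_submod/ideal_gen_ideal.
Qed.

(** The Hilbert series of [S / Q] is [(1 + t)^(n+1)]. *)
Lemma codim_gen d : codim Q d = 'C(n.+1, d).
Proof.
have hf' : {in f : seq S, forall q, q \is 2.-homog} by move=> q /tnthP[i ->].
have := @codim_take _ _ f n.+1 d hf' reg; rewrite size_tuple subnn.
by rewrite take_oversize ?size_tuple // => ->.
Qed.

(** Upper bound for [Q^s / Q^(s+1)] in degree [2s + e]: modulo [Q^(s+1)], the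
    coefficients of the monomials of degree [s] in [f] may be taken in a fixed
    complement of [Q]. *)
Lemma pow_step s e : (\dim (W s (2 * s + e)) <=
  \dim (W s.+1 (2 * s + e)) + 'C(s + n, s) * 'C(n.+1, e))%N.
Proof.
set d := (2 * s + e)%N.
pose V := (piece Q e)^C%VS.
pose b := mons n.+1 s.
pose G (i : 'I_(size b)) := (hmul (fmon f (nth 0%MM b i)) e d @: V)%VS.
have hb (i : 'I_(size b)) : mdeg (nth 0%MM b i) = s.
  by apply/eqP; rewrite -mem_mons mem_nth.
have sub : (W s d <= W s.+1 d + \sum_i G i)%VS.
  apply/subvP=> x; rewrite mem_pow => /asboolP.
  rewrite size_map -/b => -[c Ex].
  have dec i : exists2 u, u \in piece Q e &
      exists2 v, v \in V & hproj e (c i) = u + v.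
    by apply/memv_addP; rewrite addv_complf memvf.
  have [u uQ vE] : exists2 u : 'I_(size b) -> Sd e,
      forall i, u i \in piece Q e &
      forall i, hproj e (c i) - u i \in V.
    exists (fun i => s2val (cid2 (dec i))) => i; case: cid2 => //=.
    move=> u _ [v vV ->].
    by rewrite addrC addKr.
  have -> : x = \sum_(i < size b) hmul (fmon f (nth 0%MM b i)) e d (u i)
     + \sum_(i < size b) hmul (fmon f (nth 0%MM b i)) e d (hproj e (c i) - u i).
    rewrite -big_split /=.
    under eq_bigr => i _ do rewrite -linearD addrC subrK.
    apply: val_inj.
    rewrite -[val x](@pihomog_dE _ _ mdeg d); last exact: dhomog_is_dhomog.
    rewrite [val x]Ex !linear_sum /=; apply: eq_bigr => i _.
    rewrite (hmulE (c := 2 * s)) ?fmon_homog //.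
    rewrite (nth_map 0%MM) ?ltn_ord // (pihomog_mul _ _ (fmon_homog (hb i))).
    by rewrite leq_addr /d addKn mulrC.
  apply: memv_add; last by apply: memv_sumr => i _; apply: memv_img.
  apply: memv_suml => i _; rewrite pieceE; last exact: exp_submod.
  rewrite (hmulE (c := 2 * s)) ?fmon_homog // mulrC; apply: ideal_mulM.
    by have := uQ i; rewrite pieceE //; apply/ideal_submod/ideal_gen_ideal.
  exact: fmon_exp.
apply: leq_trans (dimvS sub) _; apply: leq_trans (dimv_add_leqif _ _) _.
rewrite leq_add2l; apply: leq_trans (dimv_leq_sum _ xpredT G) _.
rewrite -size_basis -/(mons _ _) -/b -[X in (_ <= X * _)%N]card_ord.
rewrite -sum_nat_const.
apply: leq_sum => i _; rewrite -codim_gen /codim -dimv_compl.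
by rewrite -(limg_ker_dim (hmul (fmon f (nth 0%MM b i)) e d) V) leq_addl.
Qed.

(** The bounds of [pow_step] are all equalities, because their sum is the
    dimension of the space of forms of degree [d]. *)
Lemma codim_pow s d : codim (ideal_exp Q s) d =
  (\sum_(j < s | 2 * j <= d) 'C(j + n, j) * 'C(n.+1, d - 2 * j))%N.
Proof.
pose T a b := (\sum_(a <= j < b | 2 * j <= d)
  'C(j + n, j) * 'C(n.+1, d - 2 * j))%N.
have Tcat a b c : (a <= b -> b <= c -> T a c = T a b + T b c)%N.
  by move=> ab bc; rewrite /T (big_cat_nat ab bc).
have step a : (\dim (W a d) <= \dim (W a.+1 d) + T a a.+1)%N.
  rewrite /T big_mkcond big_nat1; case: (leqP (2 * a) d) => [ad|/pow_small->].
    by have := pow_step a (d - 2 * a); rewrite subnKC.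
  by rewrite dimv0.
have tele a m : (\dim (W a d) <= \dim (W (a + m) d) + T a (a + m)%N)%N.
  elim: m => [|m IHm]; first by rewrite addn0 /T big_geq ?addn0.
  rewrite addnS (Tcat a (a + m)%N) ?leq_addr //.
  by move: (step (a + m)%N); lia.
have W0 : W 0%N d = fullv.
  by apply/vspaceP=> x; rewrite memvf pieceE //; apply: exp_submod.
have tot : \dim {: Sd d} = T 0%N (s + d.+1)%N.
  rewrite dimS; have := hsc_poly n d; rewrite hsc_sum => <-.
  rewrite /T big_mkord (big_ord_widen (s + d.+1)
    (fun j => 'C((n.+1 + j).-1, j) * 'C(0 + n.+1, d - 2 * j))%N); last lia.
  apply: eq_big => [i|i _]; first by apply/idP/idP; lia.
  by rewrite addSn addnC.
(* The filtration is exhausted by then, since [d < 2 * (s + d.+1)]. *)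
have Wz : \dim (W (s + d.+1)%N d) = 0%N by rewrite pow_small ?dimv0 //; lia.
have := tele 0%N s; have := tele s d.+1; rewrite W0 Wz !add0n.
have := codimE (ideal_exp Q s) d; rewrite tot (Tcat 0%N s) ?leq_addr //.
by rewrite -(big_mkord (fun j => 2 * j <= d)%N
  (fun j => 'C(j + n, j) * 'C(n.+1, d - 2 * j))%N) -/(T 0%N s); lia.
Qed.

End PowerCodim.

(** * Graded pieces of a quotient *)

Section QuotientPieces.
Variables (k : fieldType) (n : nat) (I : submodClosed {mpoly k[n.+1]}).
Local Notation Sd d := (dhomog n.+1 k d).

Lemma quot_proj_linear : linear (quot_proj I).
Proof. by move=> a x y; rewrite quot_projD -quot_projZ. Qed.
HB.instance Definition _ :=
  GRing.isLinear.Build k {mpoly k[n.+1]} (quotmod I) _ (quot_proj I)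
    quot_proj_linear.

Lemma quot_proj_eq0 v : (quot_proj I v == 0) = (v \in I).
Proof.
by rewrite -(linear0 (quot_proj I)) /quot_proj -Quotient.idealrBE subr0.
Qed.

(** A basis is the image of a basis of a complement of the degree [d] piece of
    [I]. *)
Lemma quot_piece_dim d : has_dim (@quot_graded_piece k n.+1 I d) (codim I d).
Proof.
have cI : GRing.submod_closed I.
  by split=> [|a x y xI yI]; rewrite ?rpred0 ?rpredD ?rpredZ.
pose U := piece I d.
have {1}-> : codim I d = \dim (U^C)%VS by rewrite dimv_compl.
pose b := vbasis (U^C)%VS.
have bP : basis_of (U^C)%VS b := vbasisP _.
exists (fun i => quot_proj I (val b`_i)); split=> [i|c c0 i|_ [p hp ->]].
- by exists (val b`_i) => //; apply: dhomog_is_dhomog.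
- have /freeP := basis_free bP; apply.
  have memU : \sum_i c i *: b`_i \in U.
    rewrite pieceE // -quot_proj_eq0 -c0 !linear_sum /=.
    by apply/eqP/eq_bigr => j _; rewrite !linearZ.
  have memUC : \sum_i c i *: b`_i \in (U^C)%VS.
    apply: memv_suml => j _.
    by rewrite memvZ // (basis_mem bP) // mem_nth ?size_tuple.
  by apply/eqP; rewrite -memv0 -(capv_compl U) memv_cap memU.
have /memv_addP[u uU [v vC Ep]] : (DHomog hp : Sd d) \in (U + U^C)%VS.
  by rewrite addv_complf memvf.
exists (fun i => coord b i v).
have -> : p = val u + val v by rewrite -[p]/(val (DHomog hp : Sd d)) Ep.
rewrite pieceE // -quot_proj_eq0 in uU.
rewrite linearD /= (eqP uU) add0r {1}(coord_basis bP vC) !linear_sum /=.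
by apply: eq_bigr => i _; rewrite !linearZ.
Qed.

End QuotientPieces.

(** * The coefficients of the two sums *)

Lemma coef_sum_nat (a b d : nat) (F : nat -> nat) :
  (\sum_(a <= i < b) F i *: 'X^i : {poly nat})`_d =
  if (a <= d < b)%N then F d else 0%N.
Proof.
rewrite coef_sum -(@big_nat1_eq nat 0%N addn F d) [RHS]big_mkcond.
apply: eq_bigr => i _.
by rewrite coefZ coefXn eq_sym; case: eqP => _; rewrite ?mulr1 ?mulr0.
Qed.

(** From degree [2s] on, the coefficient is given by the second sum, whose upper
    bound only cuts off zero terms. *)
Lemma hilbert_coef (n s d : nat) :
  (\sum_(0 <= i < (2 * s)%N) 'C((i + n.+1 - 1)%N, (n.+1 - 1)%N) *: 'X^i
   + \sum_((2 * s)%N <= i < (2 * s + n.+1 - 1)%N) \sum_(0 <= j < s)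
       ('C((n.+1 + j - 1)%N, (n.+1 - 1)%N) * 'C(n.+1, (i - 2 * j)%N))%N *: 'X^i
   : {poly nat})`_d =
  if (d < 2 * s)%N then 'C(d + n, d)
  else (\sum_(j < s | 2 * j <= d) 'C(j + n, j) * 'C(n.+1, d - 2 * j))%N.
Proof.
rewrite [X in _ + X](eq_bigr (fun i => (\sum_(0 <= j < s)
    'C(n + j, n) * 'C(n.+1, i - 2 * j))%N *: 'X^i)); last first.
  move=> i _; rewrite scaler_suml; apply: eq_bigr => j _.
  by rewrite !addSn !subn1.
rewrite coefD !coef_sum_nat leq0n /=.
case: (ltnP d (2 * s)) => ds /=.
  by rewrite addr0 addnS !subn1 /= -bin_sub ?leq_addl // addnK.
rewrite add0r; case: ltnP => dn.
  rewrite big_mkord; apply: eq_big => [j|j _]; first by have := ltn_ord j; lia.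
  by rewrite addnC -bin_sub ?leq_addl // addnK.
rewrite big1 // => j _; rewrite [X in (_ * X)%N]bin_small ?muln0 //.
by have := ltn_ord j; lia.
Qed.

Theorem corollary6 (k : fieldType) (n : nat) (hn : (1 <= n)%N)
    (f : n.-tuple {mpoly k[n]})
    (hdeg : forall j : 'I_n, tnth f j \is 2.-homog)
    (hreg : regular_sequence f)
    (s : nat) (hs : (1 <= s)%N) :
  has_hilbert_series (ideal_exp (ideal_gen f) s)
    (fun d =>
      (\sum_(0 <= i < (2 * s)%N) 'C((i + n - 1)%N, (n - 1)%N) *: 'X^i
       + \sum_((2 * s)%N <= i < (2 * s + n - 1)%N) \sum_(0 <= j < s)
           ('C((n + j - 1)%N, (n - 1)%N) * 'C(n, (i - 2 * j)%N))%N *: 'X^i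
       : {poly nat})`_d).
Proof.
case: n hn f hdeg hreg => // n _ f hdeg hreg d.
have -> := hilbert_coef n s d.
case: ifP => ds.
  have := quot_piece_dim (ideal_exp (ideal_gen f) s) d.
  by rewrite /codim pow_small // dimv0 subn0 dimS.
by rewrite -(codim_pow hdeg hreg); apply: quot_piece_dim.
Qed.
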